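(* Let $\alpha$ be a real number and let $Z$ be a complex random variable with $|Z-\mathbb{E} Z|\le \alpha$ almost surely. Then \[ \bigl|\mathbb{E}\, e^{Z-\mathbb{E} Z}-1\bigr| \le e^{\alpha^2/2}-1. \] *)

(* Defs.v *)
From HB Require Import structures.
From mathcomp Require Import all_boot all_order all_algebra.
From mathcomp Require Import complex.
From mathcomp Require Import all_classical all_reals all_analysis.

Set Implicit Arguments.
Unset Strict Implicit.
Unset Printing Implicit Defensive.

Import Order.TTheory GRing.Theory Num.Theory.
Import numFieldNormedType.Exports.

Local Open Scope classical_set_scope.
Local Open Scope ring_scope.
Local Open Scope complex_scope.

(* [R[i]] carries no sigma-algebra in the libraries. The Borel sigma-algebra of
   the plane is the product one, so measurability is componentwise. *)
Definition complex_random_variable (d : measure_display) (T : measurableType d)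
    (R : realType) (P : probability T R) (Z : T -> R[i]) : Prop :=
  measurable_fun [set: T] (fun t => complex.Re (Z t)) /\
  measurable_fun [set: T] (fun t => complex.Im (Z t)).

(* As [fine] is total, this has an arbitrary value when a component is not
   integrable. A random variable almost surely within a fixed distance of some
   complex number has integrable components, whatever that number is, and then
   this is its mean. *)
Definition complex_expectation (d : measure_display) (T : measurableType d)
    (R : realType) (P : probability T R) (Z : T -> R[i]) : R[i] :=
  fine 'E_P[fun t => complex.Re (Z t)] +i* fine 'E_P[fun t => complex.Im (Z t)].

Definition complex_exp (R : realType) (z : R[i]) : R[i] :=
  (expR (complex.Re z))%:C * (cos (complex.Im z) +i* sin (complex.Im z)).

(* Main.v *)
(* Put W = Z - E Z and a = alpha. As E W = 0, we have
   E e^W - 1 = E (e^W - 1 - l W) for every constant l, so it is enough to find an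
   l with |e^w - 1 - l w| <= e^{a^2/2} - 1 on the whole disc |w| <= a. The choice
   l = int_0^1 e^{(a s)^2/2} ds works: along the ray s |-> s w, the function
   e^{sw} - 1 - w int_0^s e^{(a r)^2/2} dr has derivative
   w (e^{sw} - e^{(a s)^2/2}), and e^{(a s)^2/2} - 1 has derivative
   a (a s) e^{(a s)^2/2}, so it suffices that |e^z - e^{r^2/2}| <= r e^{r^2/2}
   for |z| <= r. By cos y >= 1 - y^2/2 this reduces to a one-variable inequality
   in u = Re z - r^2/2. *)
Require Import Defs.
From HB Require Import structures.
From mathcomp Require Import all_boot all_order all_algebra.
From mathcomp Require Import complex.
From mathcomp Require Import all_classical all_reals all_analysis.
From mathcomp Require Import measurable_realfun.
From mathcomp Require Import ring lra.

Set Implicit Arguments.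
Unset Strict Implicit.
Unset Printing Implicit Defensive.

Import Order.TTheory GRing.Theory Num.Theory.
Import numFieldNormedType.Exports.

Local Open Scope classical_set_scope.
Local Open Scope ring_scope.
Local Open Scope complex_scope.

(** * One-variable bounds for the exponential, by repeated differentiation *)

Lemma is_derive1_ge0 (R : realType) (f df : R -> R) (b : R) :
  (forall x, 0 <= x <= b -> is_derive x 1 f (df x)) ->
  (forall x, 0 <= x <= b -> 0 <= df x) ->
  0 <= f 0 -> forall x, 0 <= x <= b -> 0 <= f x.
Proof.
move=> fdf df_ge0 f0 x /andP[x0 xb].
have [z zx fE] : exists2 c, c \in `[0, x]%R & f x - f 0 = df c * (x - 0).
  apply: MVT_segment => // [z|].
    rewrite in_itv/= => /andP[z0 zx]; apply: fdf.
    by rewrite (ltW z0) (le_trans (ltW zx)).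
  apply: derivable_within_continuous => z; rewrite in_itv/= => /andP[z0 zx].
  by have [] := fdf z; rewrite // z0 (le_trans zx).
move: zx; rewrite in_itv/= => /andP[z0 zx].
have dfz : 0 <= df z by apply: df_ge0; rewrite z0 (le_trans zx).
rewrite subr0 in fE; rewrite -(subrK (f 0) (f x)) fE addr_ge0 ?mulr_ge0//.
Qed.

(** The value 5 serves the fourth derivative in [expRD_expRN_le]. The twelfth power of e^{-1/8} >=
    7/8 gives e^{3/2} <= (8/7)^12, just below 5. *)
Lemma expR_half_lt (R : realType) : expR (3 / 2 : R) < 5.
Proof.
have h : 7 / 8 <= expR (- (1 / 8)) :> R.
  by apply: le_trans (expR_ge1Dx _); lra.
have : expR (3 / 2) * expR (- (1 / 8)) ^+ 12 = 1 :> R.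
  rewrite -expRM_natl -expRD -[RHS](@expR0 R); congr expR. by lra.
have h12 : (7 / 8) ^+ 12 <= expR (- (1 / 8)) ^+ 12 :> R.
  by rewrite lerXn2r// nnegrE ?expR_ge0//; lra.
have := expR_gt0 (3 / 2 : R).
set e := expR (3 / 2); set k := _ ^+ 12 in h12 * => e0 ek.
have : e * (7 / 8) ^+ 12 <= 1 by rewrite -[leRHS]ek ler_pM2l.
by lra.
Qed.

(** The Taylor coefficient of v^4 is 1/12; with the larger 1/4 the difference has fourth derivative
    6 - e^v - e^{-v}, nonnegative up to 3/2. The difference and its lower derivatives vanish at 0,
    so four integrations conclude. *)
Lemma expRD_expRN_le (R : realType) (v : R) : 0 <= v <= 3 / 2 ->
  expR v + expR (- v) <= 2 + v ^+ 2 + v ^+ 4 / 4.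
Proof.
move=> vP.
have d4 (x : R) : 0 <= x <= 3 / 2 -> 0 <= 6 - expR x - expR (- x).
  move=> /andP[x0 xb].
  have : expR x <= expR (3 / 2) by rewrite ler_expR.
  have : expR (- x) <= 1 by rewrite expR_le1 oppr_le0.
  by have := expR_half_lt R; lra.
have d3 (x : R) : 0 <= x <= 3 / 2 -> 0 <= 6 * x - expR x + expR (- x).
  move: x; apply: (is_derive1_ge0 _ d4) => [x _|]; last first.
    by rewrite oppr0 expR0; lra.
  apply: is_derive_eq.
  by rewrite /GRing.scale/=; ring.
have d2 (x : R) : 0 <= x <= 3 / 2 -> 0 <= 2 + 3 * x ^+ 2 - expR x - expR (- x).
  move: x; apply: (is_derive1_ge0 _ d3) => [x _|]; last first.
    by rewrite oppr0 expR0; lra.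
  apply: is_derive_eq.
  by rewrite /GRing.scale/=; ring.
have d1 (x : R) : 0 <= x <= 3 / 2 ->
    0 <= 2 * x + x ^+ 3 - expR x + expR (- x).
  move: x; apply: (is_derive1_ge0 _ d2) => [x _|]; last first.
    by rewrite oppr0 expR0; lra.
  apply: is_derive_eq.
  by rewrite /GRing.scale/=; ring.
rewrite -subr_ge0.
move: v vP; apply: (is_derive1_ge0 _ d1) => [x _|]; last first.
  by rewrite oppr0 expR0; lra.
apply: is_derive_eq.
by rewrite /GRing.scale/=; field.
Qed.

Lemma expR_ge_quadratic (R : realType) (v : R) : 0 <= v ->
  1 + v + v ^+ 2 / 2 <= expR v.
Proof.
move=> v0.
have d1 (x : R) : 0 <= x <= v -> 0 <= expR x - 1 - x.
  by move=> _; have := expR_ge1Dx x; lra.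
have vv : 0 <= v <= v by rewrite v0 lexx.
suff /(_ v vv) : forall x, 0 <= x <= v -> 0 <= expR x - (1 + x + x ^+ 2 / 2).
  by rewrite subr_ge0.
apply: (@is_derive1_ge0 _ _ _ v _ d1) => [x _|]; last by rewrite expR0; lra.
apply: is_derive_eq.
by rewrite /GRing.scale/=; field.
Qed.

Lemma expRN_le_quadratic (R : realType) (v : R) : 0 <= v ->
  expR (- v) <= 1 - v + v ^+ 2 / 2.
Proof.
move=> v0.
have d1 (x : R) : 0 <= x <= v -> 0 <= expR (- x) - 1 + x.
  by move=> _; have := expR_ge1Dx (- x); lra.
have vv : 0 <= v <= v by rewrite v0 lexx.
suff /(_ v vv) : forall x, 0 <= x <= v -> 0 <= 1 - x + x ^+ 2 / 2 - expR (- x).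
  by rewrite subr_ge0.
apply: (@is_derive1_ge0 _ _ _ v _ d1) => [x _|].
  apply: is_derive_eq.
  by rewrite /GRing.scale/=; field.
by rewrite oppr0 expR0; lra.
Qed.

(** * The disc estimate for the complex exponential *)

(** Squaring |e^z - e^{a^2/2}| <= a e^{a^2/2}, dividing by e^{a^2} e^u and inserting cos y >= 1 -
    y^2/2 and y^2 <= a^2 - x^2 leaves this inequality as a sufficient condition. *)
Lemma expR_disc_aux (R : realType) (a x : R) : 0 <= a -> - a <= x <= a ->
  let u := x - a ^+ 2 / 2 in
  (1 - a ^+ 2) * expR (- u) + expR u <= 2 - a ^+ 2 + x ^+ 2.
Proof.
move=> a0 /andP[ax xa]; set u := x - _ => /=.
move: ax xa; have -> : x = u + a ^+ 2 / 2 by rewrite /u; ring.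
move: u => u ax xa {x}.
suff : expR u + expR (- u) <=
    2 + u ^+ 2 + a ^+ 2 * (expR (- u) - 1 + u) + a ^+ 4 / 4.
  by lra.
have eN : 1 - u <= expR (- u) by exact: expR_ge1Dx.
have a2 : 0 <= a ^+ 2 by exact: sqr_ge0.
have p0 : 0 <= a ^+ 2 * (expR (- u) - 1 + u) by apply: mulr_ge0 => //; lra.
have [u0|u0] := leP 0 u.
  have ua : u <= a by lra.
  have u12 : u <= 1 / 2 by have := sqr_ge0 (a - 1); lra.
  have := @expRD_expRN_le R u ltac:(lra).
  have : u ^+ 4 <= a ^+ 4 by rewrite lerXn2r.
  by lra.
(* For u < 0 and a >= 1, the factor a^2 >= 1 lets that term absorb e^{-u} entirely. *)
have [a1|a1] := leP 1 a.
  have eu : expR u <= 1 + u + u ^+ 2 / 2.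
    by have := @expRN_le_quadratic R (- u) ltac:(lra); rewrite opprK; lra.
  have a21 : 1 <= a ^+ 2 by rewrite expr_ge1.
  have : 0 <= a ^+ 4 by rewrite exprn_ge0.
  have := sqr_ge0 u.
  have : 1 * (expR (- u) - 1 + u) <= a ^+ 2 * (expR (- u) - 1 + u).
    by rewrite ler_wpM2r//; lra.
  by lra.
have eN2 : 1 - u + u ^+ 2 / 2 <= expR (- u).
  by have := @expR_ge_quadratic R (- u) ltac:(lra); lra.
(* This comes from -u <= a + a^2/2 and a < 1. It gives a^2 >= 4 u^2 / 9, and the quartic terms then
   close because 2/9 + 4/81 = 22/81 exceeds 1/4. *)
have ua : - u <= 3 / 2 * a by nra.
have := @expRD_expRN_le R (- u) ltac:(lra).
rewrite opprK.
have u2a : 4 / 9 * u ^+ 2 <= a ^+ 2 by nra.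
have : 4 / 9 * u ^+ 2 * (u ^+ 2 / 2) <= a ^+ 2 * (expR (- u) - 1 + u).
  by apply: ler_pM => //; have := sqr_ge0 u; lra.
have : (4 / 9 * u ^+ 2) ^+ 2 <= (a ^+ 2) ^+ 2.
  by rewrite lerXn2r// nnegrE; have := sqr_ge0 u; lra.
have : 0 <= u ^+ 4 by rewrite exprn_even_ge0.
by lra.
Qed.

Lemma cos_ge_quadratic (R : realType) (y : R) : 1 - y ^+ 2 / 2 <= cos y.
Proof.
wlog y0 : y / 0 <= y => [h|].
  have [|/ltW yle0] := leP 0 y; first exact: h.
  by rewrite -cosN -sqrrN h// oppr_ge0.
have yy : 0 <= y <= y by rewrite y0 lexx.
have d2 (x : R) : 0 <= x <= y -> 0 <= 1 - cos x.
  by rewrite subr_ge0 cos_le1.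
have d1 (x : R) : 0 <= x <= y -> 0 <= x - sin x.
  move: x; apply: (@is_derive1_ge0 _ _ _ y _ d2).
  by rewrite sin0 subr0.
suff /(_ y yy) : forall x, 0 <= x <= y -> 0 <= cos x - (1 - x ^+ 2 / 2).
  by rewrite subr_ge0.
apply: (@is_derive1_ge0 _ _ _ y _ d1) => [x _|].
  apply: is_derive_eq.
  by rewrite /GRing.scale/=; field.
by rewrite cos0; lra.
Qed.

(** Once e^{a^2/2} is factored out, what is left is q^2 - 2 q cos y + 1 <= a^2 for q = e^u. The
    quadratic bound on the cosine reduces it to [expR_disc_aux] multiplied by q. *)
Lemma cexp_disc_le (R : realType) (a x y : R) : 0 <= a ->
  x ^+ 2 + y ^+ 2 <= a ^+ 2 ->
  (expR x * cos y - expR (a ^+ 2 / 2)) ^+ 2 + (expR x * sin y) ^+ 2 <=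
  (a * expR (a ^+ 2 / 2)) ^+ 2.
Proof.
move=> a0 xya.
have y2 := sqr_ge0 y.
have xa : - a <= x <= a by apply/andP; split; nra.
have /= := expR_disc_aux a0 xa.
set u := x - _; set E := expR (a ^+ 2 / 2).
have -> : expR x = E * expR u by rewrite -expRD; congr expR; rewrite /u; ring.
rewrite expRN; move: (expR u) (expR_gt0 u) => q q0 qP {u}.
have {}qP : (1 - a ^+ 2) + q ^+ 2 <= (2 - a ^+ 2 + x ^+ 2) * q.
  have := ler_wpM2r (ltW q0) qP.
  by rewrite mulrDl mulfVK ?gt_eqF// -expr2.
have cosP : q * (1 - y ^+ 2 / 2) <= q * cos y.
  by rewrite ler_wpM2l ?(ltW q0)// cos_ge_quadratic.
have qy : q * (x ^+ 2 + y ^+ 2) <= q * a ^+ 2 by rewrite ler_wpM2l ?(ltW q0).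
have -> : (E * q * cos y - E) ^+ 2 + (E * q * sin y) ^+ 2 =
    E ^+ 2 * (q ^+ 2 * (cos y ^+ 2 + sin y ^+ 2) - 2 * (q * cos y) + 1).
  by ring.
rewrite cos2Dsin2 mulr1 exprMn mulrC ler_wpM2r ?sqr_ge0//.
by lra.
Qed.

(** * Linear approximation of the complex exponential, tested in real directions *)

Lemma primitive_on_itv01 (R : realType) (f : R -> R) : continuous f ->
  exists F : R -> R, F 0 = 0 /\
    forall x : R, 0 <= x <= 1 -> is_derive x 1 F (f x).
Proof.
move=> cf; pose mu := @lebesgue_measure R.
(* The base point -1, and the upper end 2 used below, make every point of [0, 1] interior, so the
   derivatives at 0 and 1 are two-sided. *)
pose G x := (\int[mu]_(t in `[(-1)%R, x]) f t)%R.
have dG (x : R) : 0 <= x <= 1 -> is_derive x 1 G (f x).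
  move=> /andP[x0 x1].
  have [|||//|dGx Gx] := @continuous_FTC1_closed R f (-1) x 2.
  - by lra.
  - apply: continuous_compact_integrable; first exact: segment_compact.
    exact: continuous_subspaceT.
  - by lra.
  - exact: cf.
  - by rewrite -Gx derive1E; exact: derivableP.
exists (fun x => G x - G 0); split=> [|x x01]; first by rewrite subrr.
have := dG x x01 => dGx.
by apply: is_derive_eq; rewrite subr0.
Qed.

(** The left side is the component along (p, q) of the product (x + iy)(c + is), so the modulus of
    the product bounds it. The gap between the squares is the square of the component along (-q,
    p). *)
Lemma cauchy_schwarz_cmul (R : realDomainType) (p q x y c s k l : R) :
  p ^+ 2 + q ^+ 2 = 1 -> 0 <= k -> 0 <= l ->
  x ^+ 2 + y ^+ 2 <= k ^+ 2 -> c ^+ 2 + s ^+ 2 <= l ^+ 2 ->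
  p * (x * c - y * s) + q * (x * s + y * c) <= k * l.
Proof.
move=> pq k0 l0 xyk csl; set z := _ + _.
have [z0|/ltW z0] := leP z 0; first by rewrite (le_trans z0) ?mulr_ge0.
rewrite -ler_sqr ?nnegrE ?mulr_ge0// exprMn.
have : (x ^+ 2 + y ^+ 2) * (c ^+ 2 + s ^+ 2) <= k ^+ 2 * l ^+ 2.
  by apply: ler_pM => //; rewrite addr_ge0 ?sqr_ge0.
apply: le_trans.
have -> : (x ^+ 2 + y ^+ 2) * (c ^+ 2 + s ^+ 2) =
    (p ^+ 2 + q ^+ 2) * ((x ^+ 2 + y ^+ 2) * (c ^+ 2 + s ^+ 2)).
  by rewrite pq mul1r.
rewrite -subr_ge0 (_ : _ - _ =
  (p * (x * s + y * c) - q * (x * c - y * s)) ^+ 2) ?sqr_ge0//.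
by rewrite /z; ring.
Qed.

(** Testing against unit vectors (p, q) replaces a modulus by real functions, to which
    [is_derive1_ge0] applies. The constant [l] is chosen before the direction and the point, so the
    linear term can be integrated away. *)
Lemma cexp_linear_approx (R : realType) (a : R) : 0 <= a -> exists l : R,
  forall p q x y : R, p ^+ 2 + q ^+ 2 = 1 -> x ^+ 2 + y ^+ 2 <= a ^+ 2 ->
  p * (expR x * cos y - 1 - l * x) + q * (expR x * sin y - l * y) <=
  expR (a ^+ 2 / 2) - 1.
Proof.
move=> a0.
pose E t := expR ((a * t) ^+ 2 / 2).
have dE (t : R) : is_derive t 1 E (a ^+ 2 * t * E t).
  have dsq : is_derive t 1 (fun t : R => (a * t) ^+ 2 / 2) (a ^+ 2 * t).
    by apply: is_derive_eq; rewrite /GRing.scale/=; field.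
  by have := is_derive1_comp (is_derive_expR _) dsq; rewrite mulrC.
have cE : continuous E.
  move=> t; apply/differentiable_continuous/derivable1_diffP.
  by have [] := dE t.
have [L [L0 dL]] := primitive_on_itv01 cE.
exists (L 1) => p q x y pq xya.
rewrite -subr_ge0.
(* M is e^{(at)^2/2} - 1 minus the component of e^{tw} - 1 - L(t) w in the
   direction (p, q). *)
pose M t := E t - 1 - (p * (expR (t * x) * cos (t * y) - 1 - L t * x)
  + q * (expR (t * x) * sin (t * y) - L t * y)).
have -> : expR (a ^+ 2 / 2) - 1 -
    (p * (expR x * cos y - 1 - L 1 * x) + q * (expR x * sin y - L 1 * y)) =
    M 1.
  by rewrite /M /E mulr1 !mul1r.
(* The first term is E'(t); the rest is the component along (p, q) of w (e^{tw} - E(t)), with w = x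
   + iy. Nonnegativity is [cauchy_schwarz_cmul] with |w| <= a and the disc estimate of radius a
   t. *)
pose dM t := a * (a * t * E t) -
  (p * (x * (expR (t * x) * cos (t * y) - E t)
        - y * (expR (t * x) * sin (t * y)))
  + q * (x * (expR (t * x) * sin (t * y))
         + y * (expR (t * x) * cos (t * y) - E t))).
apply: (@is_derive1_ge0 _ M dM 1) => [t t01|t /andP[t0 t1]||].
- have := dL t t01 => dLt.
  have dxt z : is_derive t 1 (fun t : R => t * z) z.
    by apply: is_derive_eq; rewrite /GRing.scale/= mulr0 add0r mulr1.
  have dexp : is_derive t 1 (fun t : R => expR (t * x)) (x * expR (t * x)).
    by have := is_derive1_comp (is_derive_expR _) (dxt x); rewrite mulrC.
  have dcos : is_derive t 1 (fun t : R => cos (t * y)) (- y * sin (t * y)).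
    have := is_derive1_comp (is_derive_cos _) (dxt y).
    by rewrite mulNr mulrC -mulNr.
  have dsin : is_derive t 1 (fun t : R => sin (t * y)) (y * cos (t * y)).
    by have := is_derive1_comp (is_derive_sin _) (dxt y); rewrite mulrC.
  rewrite /M; apply: is_derive_eq.
  rewrite /GRing.scale/= /dM; ring.
- rewrite subr_ge0; apply: cauchy_schwarz_cmul => //.
    by rewrite !mulr_ge0 ?expR_ge0.
  apply: cexp_disc_le; first by rewrite mulr_ge0.
  rewrite !exprMn -mulrDr mulrC.
  by rewrite ler_wpM2r ?sqr_ge0.
- by rewrite /M /E L0 mulr0 !mul0r expr0n/= mul0r expR0 cos0 sin0; lra.
- by rewrite ler01 lexx.
Qed.

(** The direction of (u, v) itself attains the norm; for the zero vector, two opposite directions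
    together force b >= 0. *)
Lemma le_norm_of_directions (R : rcfType) (u v b : R) :
  (forall p q, p ^+ 2 + q ^+ 2 = 1 -> p * u + q * v <= b) ->
  Num.sqrt (u ^+ 2 + v ^+ 2) <= b.
Proof.
move=> h; set r := Num.sqrt _.
have r2 : r ^+ 2 = u ^+ 2 + v ^+ 2 by rewrite sqr_sqrtr ?addr_ge0 ?sqr_ge0.
have [r0|r_neq0] := eqVneq r 0.
  have u0 : u ^+ 2 = 0.
    by move: r2; rewrite r0; have := sqr_ge0 u; have := sqr_ge0 v; lra.
  have := h 1 0; have := h (-1) 0.
  by rewrite r0; lra.
have := h (u / r) (v / r).
have -> : (u / r) ^+ 2 + (v / r) ^+ 2 = 1.
  by rewrite !expr_div_n -mulrDl -r2 divff// sqrf_eq0.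
move=> /(_ erefl); congr (_ <= _).
by rewrite mulrAC [v / r * v]mulrAC -mulrDl -!expr2 -r2 expr2 mulfK.
Qed.

(** * Integrals of almost surely bounded random variables, and the passage to expectations *)

Section bounded_random_variable.
Context d (T : measurableType d) (R : realType) (P : probability T R).

Lemma ae_bounded_integrable (f : T -> R) (b : R) :
  measurable_fun [set: T] f -> (\forall t \ae P, `|f t| <= b) ->
  P.-integrable [set: T] (EFin \o f).
Proof.
move=> mf fb; apply/integrableP; split; first exact/measurable_EFinP.
apply: (@le_lt_trans _ _ (`|b|%:E * P [set: T])%E).
  apply: integral_le_bound => //; first exact/measurable_EFinP.
  apply: filterS fb => t ftb _ /=.
  by rewrite lee_fin (le_trans ftb) ?ler_norm.
by rewrite probability_setT mule1 ltry.
Qed.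

Lemma ae_bounded_Rintegral_le (f : T -> R) (b : R) :
  measurable_fun [set: T] f -> (\forall t \ae P, `|f t| <= b) ->
  0 <= b -> \int[P]_t f t <= b.
Proof.
move=> mf fb b0; have fi := ae_bounded_integrable mf fb.
rewrite (le_trans (ler_norm _))// -lee_fin EFin_normr_Rintegral//.
rewrite (le_trans (le_abse_integral _ _ _))//; first exact/measurable_EFinP.
rewrite -[leRHS]mule1 -(probability_setT P).
apply: integral_le_bound => //; first exact/measurable_EFinP.
by apply: filterS fb => t ftb _.
Qed.

Lemma fine_expectation (f : T -> R) : fine 'E_P[f] = (\int[P]_t f t)%R.
Proof. by rewrite unlock. Qed.

End bounded_random_variable.

Theorem corollary1p1 (d : measure_display) (T : measurableType d)
    (R : realType) (P : probability T R) (alpha : R) (Z : T -> R[i])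
    (hZ : complex_random_variable P Z)
    (hbound : \forall t \ae P, `|Z t - complex_expectation P Z| <= alpha%:C) :
  `|complex_expectation P (fun t => complex_exp (Z t - complex_expectation P Z)) - 1|
    <= (expR (alpha ^+ 2 / 2) - 1)%:C.
Proof.
case: hZ => mRe mIm.
set m := complex_expectation P Z.
pose X t := complex.Re (Z t) - complex.Re m.
pose Y t := complex.Im (Z t) - complex.Im m.
have ZE t : Z t - m = X t +i* Y t by rewrite /X /Y; case: (Z t); case: (m).
have mX : measurable_fun [set: T] X by exact: measurable_funB.
have mY : measurable_fun [set: T] Y by exact: measurable_funB.
have XYa : \forall t \ae P, 0 <= alpha /\ X t ^+ 2 + Y t ^+ 2 <= alpha ^+ 2.
  apply: filterS hbound => t; rewrite -/m ZE normc_def/= lecR => h.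
  have a0 := le_trans (sqrtr_ge0 _) h; split=> //.
  have : Num.sqrt (X t ^+ 2 + Y t ^+ 2) ^+ 2 <= alpha ^+ 2.
    by rewrite lerXn2r ?nnegrE ?sqrtr_ge0.
  by rewrite sqr_sqrtr ?addr_ge0 ?sqr_ge0.
(* An event of probability one contains a point, and at such a point [alpha] bounds a modulus. *)
have a0 : 0 <= alpha.
  have P0 : (0 < P [set: T])%E by rewrite probability_setT lte01.
  have := ae_properfilter_algebraOfSetsType P0 => ae_proper.
  by have [t []] := filter_ex XYa.
have XYn : \forall t \ae P, `|X t| <= alpha /\ `|Y t| <= alpha.
  apply: filterS XYa => t [_ XY].
  have := sqr_ge0 (X t); have := sqr_ge0 (Y t) => Y2 X2.
  by rewrite !ler_norml; split; apply/andP; split; nra.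
have iX : P.-integrable [set: T] (EFin \o X).
  apply: (ae_bounded_integrable (b := alpha)) => //.
  by apply: filterS XYn => t [].
have iY : P.-integrable [set: T] (EFin \o Y).
  apply: (ae_bounded_integrable (b := alpha)) => //.
  by apply: filterS XYn => t [].
pose U t := expR (X t) * cos (Y t); pose V t := expR (X t) * sin (Y t).
have mU : measurable_fun [set: T] U.
  apply: measurable_funM; first exact: measurableT_comp.
  apply: measurableT_comp => //.
  by apply: continuous_measurable_fun; exact: continuous_cos.
have mV : measurable_fun [set: T] V.
  apply: measurable_funM; first exact: measurableT_comp.
  apply: measurableT_comp => //.
  by apply: continuous_measurable_fun; exact: continuous_sin.
have eX : \forall t \ae P, expR (X t) <= expR alpha.
  by apply: filterS XYn => t [Xa _]; rewrite ler_expR (le_trans (ler_norm _)).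
have iU : P.-integrable [set: T] (EFin \o U).
  apply: (ae_bounded_integrable (b := expR alpha)) => //.
  apply: filterS eX => t.
  apply: le_trans; rewrite normrM (ger0_norm (expR_ge0 _)) ger_pMr ?expR_gt0//.
  exact: cos_max.
have iV : P.-integrable [set: T] (EFin \o V).
  apply: (ae_bounded_integrable (b := expR alpha)) => //.
  apply: filterS eX => t.
  apply: le_trans; rewrite normrM (ger0_norm (expR_ge0 _)) ger_pMr ?expR_gt0//.
  exact: sin_max.
have i1 c : P.-integrable [set: T] (EFin \o (fun=> c)).
  by apply: (ae_bounded_integrable (b := `|c|)) => //; exact: aeW.
have Rint1 c : \int[P]_t c = c.
  by rewrite Rintegral_cst//= probability_setT mulr1.
(* By definition Re m is [fine] of the expectation of Re Z, which is the real integral of [X] + Re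
   m. Additivity, legitimate since [X] is integrable, leaves mean zero for [X]. *)
have EX : \int[P]_t X t = 0.
  apply: (@addIr _ (complex.Re m)).
  rewrite add0r -[in LHS](Rint1 (complex.Re m)) -RintegralD//.
  transitivity (\int[P]_t complex.Re (Z t)); last by rewrite -fine_expectation.
  by apply: eq_Rintegral => t _; rewrite /X subrK.
have EY : \int[P]_t Y t = 0.
  apply: (@addIr _ (complex.Im m)).
  rewrite add0r -[in LHS](Rint1 (complex.Im m)) -RintegralD//.
  transitivity (\int[P]_t complex.Im (Z t)); last by rewrite -fine_expectation.
  by apply: eq_Rintegral => t _; rewrite /Y subrK.
have -> : complex_expectation P (fun t => complex_exp (Z t - m)) - 1 =
    (\int[P]_t U t - 1) +i* \int[P]_t V t.
  rewrite /complex_expectation !fine_expectation.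
  rewrite (_ : (fun t => complex.Re _) = U); last first.
    by apply/funext => t; rewrite ZE /complex_exp/= mul0r subr0.
  rewrite (_ : (fun t => complex.Im _) = V); last first.
    by apply/funext => t; rewrite ZE /complex_exp/= mul0r addr0.
  by apply/eqP; rewrite eq_complex/= !oppr0 !addr0 !eqxx.
rewrite normc_def/= lecR; apply: le_norm_of_directions => p q pq.
have [l hl] := cexp_linear_approx a0.
have iB (f g : T -> R) : P.-integrable [set: T] (EFin \o f) ->
    P.-integrable [set: T] (EFin \o g) ->
    P.-integrable [set: T] (EFin \o (fun t => f t - g t)).
  by move=> iF iG; exact: (integrableB measurableT iF iG).
have iZ (c : R) (f : T -> R) : P.-integrable [set: T] (EFin \o f) ->
    P.-integrable [set: T] (EFin \o (fun t => c * f t)).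
  by move=> iF; exact: (integrableZl measurableT c iF).
have iU1 := iB _ _ iU (i1 1).
have iUX := iB _ _ iU1 (iZ l _ iX).
have iVY := iB _ _ iV (iZ l _ iY).
have iUX' := iZ p _ iUX.
have iVY' := iZ q _ iVY.
have iX' := iZ l _ iX.
have iY' := iZ l _ iY.
(* This is the component along (p, q) of e^{Z - m} - 1 - l (Z - m); its linear part has mean
   zero. *)
pose W t := p * (U t - 1 - l * X t) + q * (V t - l * Y t).
have -> : p * (\int[P]_t U t - 1) + q * \int[P]_t V t = \int[P]_t W t.
  rewrite /W RintegralD// !RintegralZl// !RintegralB// !RintegralZl//.
  by rewrite Rint1 EX EY !mulr0 !subr0.
apply: ae_bounded_Rintegral_le.
- have iW : P.-integrable [set: T] (EFin \o W).
    exact: (integrableD measurableT iUX' iVY').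
  by apply/measurable_EFinP; exact: measurable_int iW.
- apply: filterS XYa => t [_ XY].
  have Wle := hl p q _ _ pq XY.
  (* The opposite direction supplies the lower bound on [W], since [ae_bounded_Rintegral_le] asks
     for a bound on the absolute value. *)
  have NWle := hl (- p) (- q) _ _ _ XY.
  rewrite ler_norml /W /U /V.
  by have := NWle ltac:(rewrite !sqrrN; exact: pq); lra.
- by rewrite subr_ge0 -[leLHS](@expR0 R) ler_expR divr_ge0 ?sqr_ge0.
Qed.
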